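(* Let $n\ge m\ge1$ and let $A$ be a complex $m\times n$ matrix. If $1\le p\le q$, then $$\|A\|_{S_p}^p\le\sigma_1^p(A)+(m-1)^{1-p/q}\left(\|A\|_{S_q}^q-\sigma_1^q(A)\right)^{p/q}.$$ Equality in this inequality is possible if and only if $\sigma_2(A)=\cdots=\sigma_m(A)$.
   Context: For an $m\times n$ complex matrix $A$, $\sigma_1(A)\ge\cdots\ge\sigma_m(A)$ are its singular values (square roots of the eigenvalues of $AA^*$, where $A^*$ is the Hermitian adjoint of $A$), and for real $p\ge1$, $\|A\|_{S_p}=\left(\sigma_1^p(A)+\cdots+\sigma_m^p(A)\right)^{1/p}$ is the Schatten $p$-norm.
   Formalization: The equality clause is proved as ''equality holds if and only if p = q or σ_2(A) = ⋯ = σ_m(A)'', since for p = q both sides always coincide (e.g. A = diag(3,2,1), p = q = 1), so the stated ''only if'' fails there. *)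

(* Defs.v *)
From HB Require Import structures.
From mathcomp Require Import all_boot all_order all_algebra.
From mathcomp Require Import complex.
From mathcomp Require Import all_classical all_reals all_analysis.
Set Implicit Arguments.
Unset Strict Implicit.
Unset Printing Implicit Defensive.
Import Order.TTheory GRing.Theory Num.Theory.
Local Open Scope ring_scope.
Local Open Scope sesquilinear_scope.

(* Roots of the characteristic polynomial, i.e. the eigenvalues repeated
   according to their algebraic multiplicity, in an unspecified order. *)
Definition eigenvalues (C : closedFieldType) (m : nat) (M : 'M[C]_m) : seq C :=
  sval (closed_field_poly_normal (char_poly M)).

(* The eigenvalues of A A^* are nonnegative reals, so taking their real part
   only changes their type; see prod_singular_values below. *)
Definition singular_values (R : realType) (m n : nat) (A : 'M[R[i]]_(m, n)) :
    seq R :=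
  sort >=%R [seq Num.sqrt (complex.Re z) | z <- eigenvalues (A *m A ^t*)].

(* Indexed from 0: [sigma A i] is the singular value usually written
   sigma_(i+1)(A); it is only meaningful for i < m. *)
Definition sigma (R : realType) (m n : nat) (A : 'M[R[i]]_(m, n)) (i : nat) : R :=
  (singular_values A)`_i.

Definition schatten_norm (R : realType) (m n : nat) (p : R)
    (A : 'M[R[i]]_(m, n)) : R :=
  (\sum_(i < m) sigma A i `^ p) `^ p^-1.

Lemma char_poly_eigenvalues (C : closedFieldType) (m : nat) (M : 'M[C]_m) :
  char_poly M = \prod_(z <- eigenvalues M) ('X - z%:P).
Proof.
rewrite /eigenvalues; case: (closed_field_poly_normal _) => rs /= {1}->.
by rewrite (monicP (char_poly_monic M)) scale1r.
Qed.

Lemma size_eigenvalues (C : closedFieldType) (m : nat) (M : 'M[C]_m) :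
  size (eigenvalues M) = m.
Proof.
have := size_char_poly M; rewrite char_poly_eigenvalues size_prod_XsubC.
by case.
Qed.

Lemma eigenvalues_mul_adj_ge0 (C : numClosedFieldType) (m n : nat)
    (A : 'M[C]_(m, n)) (z : C) :
  z \in eigenvalues (A *m A ^t*) -> 0 <= z.
Proof.
rewrite -root_prod_XsubC -char_poly_eigenvalues -eigenvalue_root_char.
case/eigenvalueP => v vM v0.
have nrm k (w : 'rV[C]_k) : (w *m w ^t*) 0 0 = \sum_j `|w 0 j| ^+ 2.
  by rewrite mxE; apply: eq_bigr => j _; rewrite !mxE normCK.
have e : \sum_j `|(v *m A) 0 j| ^+ 2 = z * \sum_j `|v 0 j| ^+ 2.
  rewrite -!nrm trmx_mul map_mxM/= -mulmxA (mulmxA A) mulmxA vM.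
  by rewrite -scalemxAl mxE.
have vpos : 0 < \sum_j `|v 0 j| ^+ 2.
  rewrite lt_def sumr_ge0 ?andbT; last by move=> j _; rewrite exprn_ge0.
  apply: contra v0 => /eqP s0; apply/eqP/rowP => j; rewrite mxE.
  have /(_ _ s0 j isT)/eqP := psumr_eq0P (fun j _ => exprn_ge0 2 (normr_ge0 (v 0 j))).
  by rewrite expf_eq0/= normr_eq0 => /eqP.
by rewrite -(pmulr_lge0 _ vpos) -e sumr_ge0// => j _; rewrite exprn_ge0.
Qed.

Lemma size_singular_values (R : realType) (m n : nat) (A : 'M[R[i]]_(m, n)) :
  size (singular_values A) = m.
Proof. by rewrite size_sort size_map size_eigenvalues. Qed.

Lemma prod_singular_values (R : realType) (m n : nat) (A : 'M[R[i]]_(m, n)) :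
  char_poly (A *m A ^t*)
  = \prod_(i < m) ('X - ((sigma A i ^+ 2)%:C%C)%:P).
Proof.
rewrite char_poly_eigenvalues.
have -> : \prod_(i < m) ('X - ((sigma A i ^+ 2)%:C%C)%:P)
    = \prod_(s <- singular_values A) ('X - ((s ^+ 2)%:C%C)%:P).
  by rewrite (big_nth 0) size_singular_values big_mkord.
rewrite (perm_big _ (permEl (perm_sort _ _))) big_map.
rewrite big_seq [RHS]big_seq.
apply: eq_bigr => z /eigenvalues_mul_adj_ge0.
case: z => a b; rewrite lecE/= => /andP[/eqP b0 a0].
by rewrite sqr_sqrtr// b0.
Qed.

Lemma le_sigma (R : realType) (m n : nat) (A : 'M[R[i]]_(m, n)) (i j : nat) :
  (i <= j < m)%N -> sigma A j <= sigma A i.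
Proof.
move=> /andP[ij jm]; have im := leq_ltn_trans ij jm.
have srt : sorted >=%R (singular_values A).
  by apply: sort_sorted => x y; rewrite /= orbC le_total.
have tr : transitive (>=%R : rel R) by move=> y x z xy yz; exact: le_trans yz xy.
by apply: (sorted_leq_nth tr (fun x => lexx x) 0 srt) => //; rewrite inE size_singular_values.
Qed.

(* Main.v *)
Require Import Defs.
From HB Require Import structures.
From mathcomp Require Import all_boot all_order all_algebra.
From mathcomp Require Import complex.
From mathcomp Require Import all_classical all_reals all_analysis.
From mathcomp Require Import ring lra.
Import Order.TTheory GRing.Theory Num.Theory.
Local Open Scope ring_scope.

(** With [y_i = sigma_i^q] for the non-leading singular values and
    [s = p / q], the claim is [\sum y_i^s <= k^(1-s) (\sum y_i)^s] for [k]
    numbers. Sum the tangent line inequality for the strictly concave function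
    [y^s] at the mean of the [y_i]; it is an equality only at the mean. *)

Lemma powR_le_tangent1 (R : realType) (s y : R) : 0 < s < 1 -> 0 <= y ->
  y `^ s <= 1 + s * (y - 1) ?= iff (y == 1).
Proof.
(* At [y = 0], where the logarithm argument fails, the claim is just [0 < 1 - s]. *)
move=> /andP[s0 s1]; rewrite le_eqVlt => /predU1P[<-|y0].
  rewrite powR0 ?lt0r_neq0// eq_sym oner_eq0.
  by apply/leifP; lra.
apply/leifP; case: eqP => [->|/eqP y1]; first by rewrite powR1 subrr mulr0 addr0.
have L0 : ln y != 0 by rewrite ln_eq0.
have G0 : 0 < y `^ s by rewrite powR_gt0.
have eG : y `^ s * expR (- s * ln y) = 1.
  by rewrite /powR gt_eqF// -expRD mulNr subrr expR0.
have ey : y `^ s * expR ((1 - s) * ln y) = y.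
  by rewrite /powR gt_eqF// -expRD -mulrDl subrKC mul1r lnK.
(* Divided by [y^s], the claim is the average, with weights [s] and [1 - s], of
   [1 + x < expR x] at [x = (1 - s) ln y] and [x = - s ln y]. *)
have h1 : 1 + (1 - s) * ln y < expR ((1 - s) * ln y).
  by rewrite expR_gt1Dx// mulf_neq0// subr_eq0 gt_eqF.
have h2 : 1 + - s * ln y < expR (- s * ln y).
  by rewrite expR_gt1Dx// mulf_neq0// oppr_eq0 gt_eqF.
have -> : 1 + s * (y - 1) = y `^ s
    * (s * expR ((1 - s) * ln y) + (1 - s) * expR (- s * ln y)).
  by rewrite [RHS]mulrDr !(mulrCA (y `^ s)) ey eG; ring.
rewrite ltr_pMr//.
have g1 : s * (1 + (1 - s) * ln y) < s * expR ((1 - s) * ln y) by rewrite ltr_pM2l.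
have g2 : (1 - s) * (1 + - s * ln y) < (1 - s) * expR (- s * ln y).
  by rewrite ltr_pM2l// subr_gt0.
by apply: le_lt_trans (ltrD g1 g2); rewrite le_eqVlt; apply/orP; left; apply/eqP; ring.
Qed.

(** By homogeneity, the tangent at [b] is the tangent at 1 applied to [y / b] and scaled by
    [b ^ s]. *)
Lemma powR_le_tangent (R : realType) (s b y : R) : 0 < s < 1 -> 0 < b -> 0 <= y ->
  y `^ s <= b `^ s * (1 + s * (y / b - 1)) ?= iff (y == b).
Proof.
move=> s01 b0 y0.
have yb0 : 0 <= y / b by rewrite divr_ge0// ltW.
have bN0 := lt0r_neq0 b0.
have {1}-> : y = b * (y / b) by rewrite mulrC divfK.
rewrite powRM ?(ltW b0)// -(inj_eq (divIf bN0)) divff//.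
have h := powR_le_tangent1 _ _ _ s01 yb0.
split; first by rewrite ler_pM2l ?powR_gt0 ?h.1.
by rewrite (inj_eq (mulfI _)) ?lt0r_neq0 ?powR_gt0 ?h.2.
Qed.

Lemma sum_powR_le (R : realType) (k : nat) (y : 'I_k -> R) (s : R) :
  0 < s < 1 -> (forall i, 0 <= y i) ->
  \sum_i y i `^ s <= k%:R `^ (1 - s) * (\sum_i y i) `^ s
    ?= iff [forall i, y i == (\sum_j y j) / k%:R].
Proof.
move=> s01 y0; have /andP[s0 s1] := s01; set Y := \sum_i y i.
have Y0 : 0 <= Y by apply: sumr_ge0.
(* For [k = 0] both sides vanish, the right one because [1 - s] is nonzero, and the equality
   condition is vacuous. *)
case: (posnP k) => [k0|k0].
  move: y y0 @Y Y0; rewrite k0 => y y0 Y Y0.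
  apply/leifP; rewrite big_ord0 powR0 ?subr_eq0 ?(gt_eqF s1)// mul0r.
  by case: ifPn => // /negP[]; apply/forallP => -[].
have kR0 : 0 < k%:R :> R by rewrite ltr0n.
(* If [Y = 0] the mean is no valid point of tangency, but then every [y i] is 0 and equality
   holds. *)
move: Y0; rewrite le_eqVlt => /predU1P[Y0|Yp].
  have yi0 i : y i = 0.
    by apply: (psumr_eq0P (P := predT)) => //; rewrite -/Y.
  rewrite -Y0 powR0 ?lt0r_neq0// mulr0 mul0r big1 => [|i _].
    by apply/leifP; case: ifPn => // /negP[]; apply/forallP => i; rewrite yi0.
  by rewrite yi0 powR0// lt0r_neq0.
set b := Y / k%:R; have b0 : 0 < b by rewrite divr_gt0.
(* Since [b] is the mean, the linear terms of the tangents cancel in the sum, leaving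
   [k * b ^ s]. *)
have -> : k%:R `^ (1 - s) * Y `^ s = \sum_i b `^ s * (1 + s * (y i / b - 1)).
  rewrite -mulr_sumr big_split/= -mulr_sumr sumrB -mulr_suml -/Y.
  rewrite !sumr_const card_ord /b invf_div mulrCA divff ?lt0r_neq0// mulr1 subrr.
  rewrite mulr0 addr0 powRM ?invr_ge0 ?ltW// -powR_inv1 ?ltW//.
  rewrite -powRrM mulN1r powRN powRB ?lt0r_neq0 ?implybT// powRr1 ?ltW//.
  by rewrite -mulr_natr; ring.
by apply: leif_sum => i _; apply: powR_le_tangent.
Qed.

Lemma sigma_ge0 (R : realType) (m n : nat) (A : 'M[R[i]]_(m, n)) (i : nat) :
  0 <= sigma A i.
Proof.
rewrite /sigma; case: (ltnP i (size (singular_values A))) => [h|h].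
  have := mem_nth 0 h; rewrite {2}/singular_values mem_sort.
  by case/mapP => z _ ->; exact: sqrtr_ge0.
by rewrite nth_default.
Qed.

Lemma schatten_norm_powR (R : realType) (m n : nat) (A : 'M[R[i]]_(m, n)) (p : R) :
  p != 0 -> schatten_norm p A `^ p = \sum_(i < m) sigma A i `^ p.
Proof.
move=> p0; rewrite /schatten_norm -powRrM mulVf// powRr1// sumr_ge0// => i _.
exact: powR_ge0.
Qed.

Theorem proposition19 (R : realType) (m n : nat) (hm : (1 <= m)%N)
    (hmn : (m <= n)%N) (A : 'M[R[i]]_(m, n)) (p q : R)
    (hp : 1 <= p) (hpq : p <= q) :
  let lhs := schatten_norm p A `^ p in
  let rhs := sigma A 0 `^ p
    + (m%:R - 1) `^ (1 - p / q)
      * (schatten_norm q A `^ q - sigma A 0 `^ q) `^ (p / q) in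
  lhs <= rhs /\
  (lhs = rhs <->
   p = q \/
   (forall i j : nat, (1 <= i < m)%N -> (1 <= j < m)%N ->
      sigma A i = sigma A j)).
Proof.
have p0 : 0 < p by lra.
have q0 : 0 < q by lra.
rewrite /= !schatten_norm_powR ?gt_eqF//.
case: m hm hmn A => // k _ _ A.
rewrite !big_ord_recl/= -natr1 addrK (addrC (sigma A 0 `^ q)) addrK.
set Y := \sum_(i < k) _ `^ q.
(* For [p = q] the factor is [k ^ 0], which is 1 even for [k = 0], so equality always holds. This is
   why [p = q] is a separate alternative in the equality case. *)
move: hpq; rewrite le_eqVlt => /predU1P[pq|pq].
  have Y0 : 0 <= Y by apply: sumr_ge0 => i _; exact: powR_ge0.
  have -> : p / q = 1 by rewrite pq divff// gt_eqF.
  rewrite subrr powRr0 mul1r powRr1// /Y -pq.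
  by split => //; split => // _; left.
have s01 : 0 < p / q < 1 by rewrite divr_gt0//= ltr_pdivrMr// mul1r.
have -> : \sum_(i < k) sigma A (bump 0 i) `^ p
    = \sum_(i < k) (sigma A (bump 0 i) `^ q) `^ (p / q).
  by apply: eq_bigr => i _; rewrite -powRrM mulrC divfK// gt_eqF.
have := sum_powR_le _ _ (fun i : 'I_k => sigma A (bump 0 i) `^ q) _ s01
  (fun=> powR_ge0 _ _).
rewrite -/Y => h; split; first by rewrite lerD2l h.
split=> [/addrI/eqP|].
  rewrite h => /forallP e; right => i j /andP[i0 im] /andP[j0 jm].
  have sq (l : nat) : (0 < l)%N -> (l < k.+1)%N -> sigma A l `^ q = Y / k%:R.
    by case: l => // l _ lk; exact: (eqP (e (Ordinal (lk : (l < k)%N)))).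
  (* All the [q]-th powers equal their mean, and [x ^ q] is injective on nonnegative reals. *)
  by apply: (powR_injective q0); rewrite ?nnegrE ?sigma_ge0 //= (sq i) // (sq j).
case=> [pq'|e]; first by rewrite pq' ltxx in pq.
congr (_ + _); apply/eqP; rewrite h; apply/forallP => i.
have bk (j : 'I_k) : (0 < bump 0 j < k.+1)%N by exact: ltn_ord.
(* All terms agree with the one at [i], so the mean is that term; the index [i] itself shows that
   [k] is positive. *)
have -> : Y = \sum_(j < k) sigma A (bump 0 i) `^ q.
  by apply: eq_bigr => j _; rewrite (e _ _ (bk j) (bk i)).
rewrite sumr_const card_ord -[X in X / _]mulr_natr mulfK// pnatr_eq0.
by rewrite -lt0n; apply: leq_trans (ltn_ord i).
Qed.
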